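(* Let $E$ be an infinite-dimensional Banach space and let $\mu\colon\mathcal B_E\to[0,+\infty)$. Then $\mu$ is an axiomatic measure of non-compactness if and only if the following five conditions hold: (a1) the family $\ker\mu=\{A\in\mathcal B_E:\mu(A)=0\}$ is non-empty; (a2) for any $A,B\in\mathcal B_E$, if $A\subseteq B$, then $\mu(A)\le\mu(B)$; (a3) $\mu(\operatorname{conv}A)=\mu(A)$ for any $A\in\mathcal B_E$; (a4) there exists $\lambda\in(0,1)$ such that $\mu(\lambda A+(1-\lambda)B)\le\lambda\mu(A)+(1-\lambda)\mu(B)$ for all $A,B\in\mathcal B_E$; (a5) if $A_n\in\mathcal B_E$ ($n\in\mathbb N$) are closed and $A_{n+1}\subseteq A_n$ for $n\in\mathbb N$ with $\mu(A_n)\to0$, then $\bigcap_{n=1}^\infty A_n$ is non-empty.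
   Context: $E$ is a real or complex Banach space; $\mathcal B_E$ denotes the family of all non-empty bounded subsets of $E$, and $\mathcal K_E\subseteq\mathcal B_E$ the subfamily of relatively compact sets. $\operatorname{conv}A$ is the (not necessarily closed) convex hull; $A+B=\{a+b: a\in A, b\in B\}$, $\lambda A=\{\lambda a: a\in A\}$. A function $\mu\colon\mathcal B_E\to[0,+\infty)$ is an axiomatic measure of non-compactness if, with $\ker\mu=\{A\in\mathcal B_E:\mu(A)=0\}$: (A1) $\ker\mu$ is non-empty and $\ker\mu\subseteq\mathcal K_E$; (A2) for all $A,B\in\mathcal B_E$, if $A\subseteq B$ then $\mu(A)\le\mu(B)$; (A3) $\mu(\operatorname{conv}A)=\mu(A)$ for all $A\in\mathcal B_E$; (A4) $\mu(\lambda A+(1-\lambda)B)\le\lambda\mu(A)+(1-\lambda)\mu(B)$ for all $A,B\in\mathcal B_E$ and all $\lambda\in[0,1]$; (A5) if $A_n\in\mathcal B_E$ ($n\in\mathbb N$) are closed, $A_{n+1}\subseteq A_n$ for all $n$, and $\mu(A_n)\to0$, then $\bigcap_{n=1}^\infty A_n\ne\emptyset$. *)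

(* Defs.v *)
From HB Require Import structures.
From mathcomp Require Import all_boot all_order all_algebra.
From mathcomp Require Import all_classical all_reals all_analysis.
From mathcomp.real_closed Require Export complex.

Set Implicit Arguments.
Unset Strict Implicit.
Unset Printing Implicit Defensive.

Import Order.TTheory GRing.Theory Num.Theory.
Import numFieldNormedType.Exports.

Local Open Scope classical_set_scope.
Local Open Scope ring_scope.

(* "Real or complex" Banach spaces are completeNormedModType (scalar_field R k). *)
Variant scalar_kind := RealScalars | ComplexScalars.

Definition scalar_field (R : realType) (k : scalar_kind) : numFieldType :=
  match k with
  | RealScalars => R
  | ComplexScalars => R[i]
  end.

Definition of_real (R : realType) (k : scalar_kind) : R -> scalar_field R k :=
  match k with
  | RealScalars => fun x => x
  | ComplexScalars => fun x => real_complex R x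
  end.
Arguments of_real {R} k x.

Section Sets.
Context {K : numFieldType} {E : normedModType K}.
Implicit Types A B : set E.

Definition set_add A B : set E := [set a + b | a in A & b in B].

Definition set_scale (c : K) A : set E := [set c *: a | a in A].

(* [convex_set] only uses coefficients [t : K] with [0 <= t <= 1]; over [R[i]]
   these are exactly the real numbers of the unit interval. *)
Definition conv_hull A : set E := smallest (@convex_set K E) A.

Definition bounded_family : set (set E) :=
  [set A | A !=set0 /\ bounded_set A].

Definition relcompact_family : set (set E) :=
  [set A | bounded_family A /\ compact (closure A)].

End Sets.

Arguments bounded_family {K} E.
Arguments relcompact_family {K} E.

Definition infinite_dimensional (K : numFieldType) (E : lmodType K) : Prop :=
  ~ exists (n : nat) (e : 'I_n -> E),
      forall x : E, exists c : 'I_n -> K, x = \sum_(i < n) c i *: e i.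

(* A function on the non-empty bounded sets is a total [mu : set E -> R] whose
   values outside [bounded_family E] are irrelevant: every condition below only
   evaluates [mu] on non-empty bounded sets. *)
Definition mnc_ker (R : realType) (K : numFieldType) (E : normedModType K)
    (mu : set E -> R) : set (set E) :=
  [set A | bounded_family E A /\ mu A = 0].

Record axiomatic_mnc (R : realType) (k : scalar_kind)
    (E : completeNormedModType (scalar_field R k)) (mu : set E -> R) : Prop := {
  mnc_ker_axiom : mnc_ker mu !=set0 /\ mnc_ker mu `<=` relcompact_family E;
  mnc_mono : forall A B : set E, bounded_family E A -> bounded_family E B ->
    A `<=` B -> mu A <= mu B;
  mnc_conv : forall A : set E, bounded_family E A -> mu (conv_hull A) = mu A;
  mnc_convex : forall A B : set E, bounded_family E A -> bounded_family E B ->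
    forall l : R, 0 <= l <= 1 ->
      mu (set_add (set_scale (of_real k l) A) (set_scale (of_real k (1 - l)) B))
        <= l * mu A + (1 - l) * mu B;
  mnc_cantor : forall A : nat -> set E,
    (forall n, bounded_family E (A n)) -> (forall n, closed (A n)) ->
    (forall n, A n.+1 `<=` A n) ->
    mu (A n) @[n --> \oo] --> (0 : R) ->
    \bigcap_n A n !=set0
}.

(* Main.v *)
Require Import Defs.
From HB Require Import structures.
From mathcomp Require Import all_boot all_order all_algebra.
From mathcomp Require Import all_classical all_reals all_analysis.
From mathcomp Require Import ring lra.

Set Implicit Arguments.
Unset Strict Implicit.
Unset Printing Implicit Defensive.

Import Order.TTheory GRing.Theory Num.Theory.
Import numFieldNormedType.Exports.

Local Open Scope classical_set_scope.
Local Open Scope ring_scope.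

(** Two conditions of an axiomatic measure of non-compactness have to be
    recovered from the weaker list: every set in the kernel is relatively
    compact, and the convexity inequality holds for all coefficients.

    Relative compactness comes from monotonicity and the Cantor property.
    If mu A = 0 and A were not relatively compact, completeness of E
    would give a sequence in A whose terms are pairwise at distance at least
    some e > 0 ([separated_seq_of_not_relcompact]).  Every tail of such a
    sequence is a closed set ([closed_separated_tail]) and is contained in A,
    so mu vanishes on it; the tails decrease, yet no point lies in all of them,
    because the terms are distinct.  This contradicts the Cantor property
    ([mnc_ker_relcompact]).

    For the convexity inequality, fix A and B and put
    phi t = mu (t A + (1 - t) B).  The inclusion
    (l s + (1 - l) u) A + (1 - (l s + (1 - l) u)) B
      <= l (s A + (1 - s) B) + (1 - l) (u A + (1 - u) B)
    ([combination_sub]), together with monotonicity, turns the inequality for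
    the single coefficient l into
    phi (l s + (1 - l) u) <= l phi s + (1 - l) phi u on [0, 1].  Monotonicity
    also bounds phi by the value of mu at one ball containing A and B.  A
    function bounded above on [0, 1] with this property lies below its chord
    ([unit_interval_chord]), and phi 1 = mu A, phi 0 = mu B. *)

(** * Separated sequences and relative compactness *)

Definition separated_seq (K : numFieldType) (E : pseudoMetricType K)
    (e : K) (x : nat -> E) : Prop :=
  forall m n, (m < n)%N -> ~ ball (x m) e (x n).

(** The list [l n] holds the terms chosen before stage [n], so that the next
    term can be chosen in relation to all of them at once. *)
Lemma greedy_avoiding_seq (T : eqType) (A : set T) (r : T -> T -> Prop) :
  (forall s : seq T, exists y, A y /\ forall x, x \in s -> r x y) ->
  exists x : nat -> T,
    (forall n, A (x n)) /\ forall m n, (m < n)%N -> r (x m) (x n).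
Proof.
move=> /choice[g gP]; pose l n := iter n (fun s => g s :: s) [::].
have g_l m n : (m < n)%N -> g (l m) \in l n.
  elim: n => // n IHn; rewrite ltnS leq_eqVlt inE => /predU1P[->|/IHn ->].
    by rewrite eqxx.
  by rewrite orbT.
exists (fun n => g (l n)); split=> [n|m n /g_l mn]; first by case: (gP (l n)).
by case: (gP (l n)) => _; apply.
Qed.

(** In a complete space an ultrafilter that contains balls of every radius is
    Cauchy, hence converges.  An ultrafilter on the closure of [A] without limit
    therefore contains the complement of every ball of some fixed radius [e].
    Finitely many such complements always meet the closure of [A], which allows
    an endless choice of new points of [A] far from the previous ones. *)
Lemma separated_seq_of_not_relcompact (K : numFieldType)
    (E : completePseudoMetricType K) (A : set E) :
  ~ compact (closure A) ->
  exists e x, [/\ 0 < e, forall n, A (x n) & separated_seq e x].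
Proof.
move=> ncA; apply: contrapT => nsep; apply: ncA.
rewrite compact_ultra => F FU FA.
suff /cauchy_cvgP Fcvg : cauchy F.
  have Flim : F --> lim F by exact: Fcvg.
  exists (lim F); split=> //.
  apply: (@closed_cvg _ _ F _ id (closure A)) => //.
  exact: closed_closure.
apply: cauchy_exP => e e0; apply: contrapT => nball.
apply: nsep; exists (e / 2).
(* The radius is halved because the point outside the balls lies in the closure
   of A and is then moved into A. *)
suff /greedy_avoiding_seq[x [Ax xsep]] : forall s : seq E,
    exists y, A y /\ forall x, x \in s -> ~ ball x (e / 2) y.
  by exists x; split=> //; rewrite divr_gt0.
move=> s.
have Fs : F [set z | forall x, x \in s -> ~ ball x e z].
  elim: s => [|x s IHs]; first by apply: filterS filterT.
  have [Fx|Fx] := in_ultra_setVsetC (ball x e) FU.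
    by case: nball; exists x.
  apply: filterS (filterI Fx IHs) => z [zx zs] y.
  by rewrite inE => /predU1P[->|/zs].
have [z [Az zs]] := filter_ex (filterI FA Fs).
have [y [Ay zy]] := Az _ (nbhsx_ballx z _ (divr_gt0 e0 (ltr0Sn _ 1))).
exists y; split=> // x /zs xz xy; apply: xz.
by apply: (ball_split xy); exact: ball_sym.
Qed.

(** A ball of radius [e / 2] around any point contains at most one term, so the
    set of terms has no limit point outside itself. *)
Lemma closed_separated_tail (K : numFieldType) (E : normedModType K)
    (e : K) (x : nat -> E) (n : nat) :
  0 < e -> separated_seq e x -> closed (x @` [set m | (n <= m)%N]).
Proof.
move=> e0 sep y ycl.
have e20 : 0 < e / 2 by rewrite divr_gt0.
have near_unique m p : ball y (e / 2) (x m) -> ball y (e / 2) (x p) -> m = p.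
  move=> ym yp; case: (ltngtP m p) => // [/sep|/sep]; case.
    exact: (ball_split (ball_sym ym) yp).
  exact: (ball_split (ball_sym yp) ym).
have nby := nbhsx_ballx y _ e20.
have [_ [[m nm <-] ym]] := ycl _ nby.
have [-> //|/eqP yxm] := eqVneq y (x m).
have nbym : nbhs y (~` [set x m]).
  apply: open_nbhs_nbhs; split=> //; apply: closed_openC.
  by apply: accessible_closed_set1; apply: hausdorff_accessible;
     exact: norm_hausdorff.
have [_ [[p np <-] [yp []]]] := ycl _ (filterI nby nbym).
by rewrite (near_unique p m).
Qed.

(** * Convexity from a single coefficient *)

(** Subtracting the chord from [phi] leaves a function [g] with the same
    [l]-convexity and with g 0 = g 1 = 0.  Each t in [0, 1] is the
    [l]-combination of an endpoint and another point of [0, 1]: of 0 if t <= l,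
    of 1 if l <= t.  With q = max l (1 - l) < 1 this gives
    sup g <= q * sup g, so sup g <= 0. *)
Lemma unit_interval_chord (R : realType) (phi : R -> R) (l C : R) :
  0 < l < 1 ->
  (forall t, 0 <= t <= 1 -> phi t <= C) ->
  (forall s u, 0 <= s <= 1 -> 0 <= u <= 1 ->
     phi (l * s + (1 - l) * u) <= l * phi s + (1 - l) * phi u) ->
  forall t, 0 <= t <= 1 -> phi t <= t * phi 1 + (1 - t) * phi 0.
Proof.
move=> /andP[l0 l1] phiC phil.
pose g t := phi t - (t * phi 1 + (1 - t) * phi 0).
have gl s u : 0 <= s <= 1 -> 0 <= u <= 1 ->
    g (l * s + (1 - l) * u) <= l * g s + (1 - l) * g u.
  move=> s01 u01; rewrite /g lerBlDr (le_trans (phil _ _ s01 u01))//.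
  by rewrite le_eqVlt; apply/orP; left; apply/eqP; ring.
have g0 : g 0 = 0 by rewrite /g; ring.
have g1 : g 1 = 0 by rewrite /g; ring.
pose G := [set g t | t in [set t | 0 <= t <= 1]].
have G0 : G 0 by exists 0 => //=; rewrite lexx ler01.
have Gsup : has_sup G.
  split; first by exists 0.
  exists (C + `|phi 1| + `|phi 0|) => _ [t /= t01 <-].
  have le_norm (s y : R) : 0 <= s <= 1 -> - (s * y) <= `|y|.
    move=> /andP[s0 s1]; rewrite (le_trans (ler_norm _))// normrN normrM.
    by rewrite (ger0_norm s0) ler_piMl.
  have t01' : 0 <= 1 - t <= 1 by lra.
  have := le_norm _ (phi 1) t01; have := le_norm _ (phi 0) t01'.
  by have := phiC t t01; rewrite /g; lra.
have leS t : 0 <= t <= 1 -> g t <= sup G.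
  by move=> t01; apply: ub_le_sup; [case: Gsup|exists t].
pose q := Num.max l (1 - l).
have S0 : 0 <= sup G by rewrite -g0 leS// lexx ler01.
have ql : l <= q by rewrite /q le_max lexx.
have ql' : 1 - l <= q by rewrite /q le_max lexx orbT.
have q1 : q < 1 by rewrite /q gt_max l1/=; lra.
have Sq : sup G <= q * sup G.
  apply: ge_sup; first by exists 0.
  move=> _ [t /= /andP[t0 t1] <-].
  have [tl|lt] := leP t l.
    have st : 0 <= t / l <= 1.
      by rewrite divr_ge0 ?(ltW l0)//= ler_pdivrMr// mul1r.
    have := gl _ 0 st; rewrite lexx ler01 => /(_ isT).
    rewrite g0 !mulr0 !addr0 mulrCA mulfV ?gt_eqF// mulr1 => /le_trans; apply.
    have := leS _ st; nra.
  have l1' : 0 < 1 - l by rewrite subr_gt0.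
  have st : 0 <= (t - l) / (1 - l) <= 1.
    rewrite divr_ge0 ?subr_ge0 ?(ltW l1) ?(ltW lt)//=.
    by rewrite ler_pdivrMr// mul1r; lra.
  have := gl 1 _ _ st; rewrite lexx ler01 => /(_ isT).
  rewrite g1 mulr0 add0r mulr1 mulrCA mulfV ?gt_eqF// mulr1 subrKC.
  move=> /le_trans; apply; have := leS _ st; nra.
move=> t /leS; rewrite /g; nra.
Qed.

(** * Convex combinations of sets *)

Section OfReal.
Context {R : realType} {k : scalar_kind}.
Implicit Types s t : R.

Lemma of_realD s t : of_real k (s + t) = of_real k s + of_real k t.
Proof. by case: k => //=; rewrite rmorphD. Qed.

Lemma of_realM s t : of_real k (s * t) = of_real k s * of_real k t.
Proof. by case: k => //=; rewrite rmorphM. Qed.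

Lemma of_real0 : of_real k (0 : R) = 0.
Proof. by case: k. Qed.

Lemma of_real1 : of_real k (1 : R) = 1.
Proof. by case: k. Qed.

Lemma of_real_ge0 t : 0 <= t -> 0 <= of_real k t.
Proof. by case: k => //= t0; rewrite ler0c. Qed.

End OfReal.

Section Combination.
Context {R : realType} {k : scalar_kind}.
Context {E : completeNormedModType (scalar_field R k)}.
Implicit Types (A B D : set E) (t : R).

Definition combination t A B : set E :=
  set_add (set_scale (of_real k t) A) (set_scale (of_real k (1 - t)) B).

Lemma combinationP t A B x :
  combination t A B x <->
  exists a b, [/\ A a, B b & x = of_real k t *: a + of_real k (1 - t) *: b].
Proof.
split=> [[_ [a Aa <-]] [_ [b Bb <-]] <-|[a [b [Aa Bb ->]]]].
  by exists a, b.
exists (of_real k t *: a); first by exists a.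
by exists (of_real k (1 - t) *: b); first by exists b.
Qed.

Lemma combination1 A B : B !=set0 -> combination 1 A B = A.
Proof.
move=> [b Bb]; apply/seteqP; split=> x.
  move=> /combinationP[a [b' [Aa _ ->]]].
  by rewrite subrr of_real0 of_real1 scale1r scale0r addr0.
move=> Ax; apply/combinationP; exists x, b; split=> //.
by rewrite subrr of_real0 of_real1 scale1r scale0r addr0.
Qed.

Lemma combination0 A B : A !=set0 -> combination 0 A B = B.
Proof.
move=> [a Aa]; apply/seteqP; split=> x.
  move=> /combinationP[a' [b [_ Bb ->]]].
  by rewrite subr0 of_real0 of_real1 scale1r scale0r add0r.
move=> Bx; apply/combinationP; exists a, x; split=> //.
by rewrite subr0 of_real0 of_real1 scale1r scale0r add0r.
Qed.

Lemma combination_sub l s u A B :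
  combination (l * s + (1 - l) * u) A B `<=`
  combination l (combination s A B) (combination u A B).
Proof.
move=> x /combinationP[a [b [Aa Bb ->]]]; apply/combinationP.
exists (of_real k s *: a + of_real k (1 - s) *: b).
exists (of_real k u *: a + of_real k (1 - u) *: b).
split; [by apply/combinationP; exists a, b|by apply/combinationP; exists a, b|].
rewrite !scalerDr !scalerA -!of_realM addrACA -!scalerDl -!of_realD.
by congr (_ + of_real k _ *: _); ring.
Qed.

(** The radius is a scalar, as in the definition of boundedness; over the
    complex numbers [M] is automatically real when the ball is non-empty. *)
Definition norm_ball (M : scalar_field R k) : set E := [set x | `|x| <= M].

Lemma combination_norm_ball M t A B : 0 <= t <= 1 ->
  A `<=` norm_ball M -> B `<=` norm_ball M ->
  combination t A B `<=` norm_ball M.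
Proof.
move=> /andP[t0 t1] AM BM x /combinationP[a [b [/AM Ma /BM Mb ->]]].
rewrite /norm_ball/= (le_trans (ler_normD _ _))// !normrZ.
have T0 := of_real_ge0 (k := k) t0.
have T1 : 0 <= of_real k (1 - t) by rewrite of_real_ge0// subr_ge0.
rewrite !ger0_norm//.
have -> : M = of_real k t * M + of_real k (1 - t) * M.
  by rewrite -mulrDl -of_realD subrKC of_real1 mul1r.
by rewrite lerD// ler_wpM2l.
Qed.

Lemma combination_nonempty t A B :
  A !=set0 -> B !=set0 -> combination t A B !=set0.
Proof.
move=> [a Aa] [b Bb]; exists (of_real k t *: a + of_real k (1 - t) *: b).
by apply/combinationP; exists a, b.
Qed.

Lemma bounded_family_sub A D :
  A !=set0 -> A `<=` D -> bounded_family E D -> bounded_family E A.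
Proof.
move=> A0 AD [_ bD]; split=> //.
by move: bD; rewrite /= /bounded_near; apply: filterS => M DM x /AD; exact: DM.
Qed.

Lemma bounded_family_norm_ball M A :
  A !=set0 -> A `<=` norm_ball M -> bounded_family E A.
Proof.
move=> A0 AM; split=> //.
have PA : ProperFilter (globally A).
  by case: A0 => a; exact: globally_properfilter.
by apply/ex_bound; exists M; exact: AM.
Qed.

Lemma bounded_family2_norm_ball A B :
  bounded_family E A -> bounded_family E B ->
  exists M, A `<=` norm_ball M /\ B `<=` norm_ball M.
Proof.
rewrite /bounded_family/= /bounded_near => -[_ bA] [_ bB].
suff near_ball :
    \forall M \near +oo, A `<=` norm_ball M /\ B `<=` norm_ball M.
  exact: filter_ex near_ball.
by move: bA bB; apply: filterS2.
Qed.

End Combination.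

(** * The kernel and the convexity inequality *)

Section Noncompactness.
Context {R : realType} {k : scalar_kind}.
Context {E : completeNormedModType (scalar_field R k)}.
Context (mu : set E -> R).
Context (mu_mono : forall A B : set E,
  bounded_family E A -> bounded_family E B -> A `<=` B -> mu A <= mu B).

(** The decreasing closed sets that would contradict the Cantor property are the
    tails of a separated sequence in [A]: a common point would be a term of the
    sequence that occurs again later. *)
Lemma mnc_ker_relcompact :
  (forall A : set E, bounded_family E A -> 0 <= mu A) ->
  (forall A : nat -> set E,
    (forall n, bounded_family E (A n)) -> (forall n, closed (A n)) ->
    (forall n, A n.+1 `<=` A n) ->
    mu (A n) @[n --> \oo] --> (0 : R) ->
    \bigcap_n A n !=set0) ->
  mnc_ker mu `<=` relcompact_family E.
Proof.
move=> mu_ge0 cantor A [bA muA]; split=> //; apply: contrapT.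
move=> /separated_seq_of_not_relcompact[e [x [e0 Ax sep]]].
pose T n := x @` [set m | (n <= m)%N].
have TA n : T n `<=` A by move=> _ [m _ <-].
have bT n : bounded_family E (T n).
  by apply: bounded_family_sub (TA n) bA; exists (x n), n => /=.
have muT n : mu (T n) = 0.
  by apply/eqP; rewrite eq_le mu_ge0// andbT -muA mu_mono.
have Tdecr n : T n.+1 `<=` T n.
  by move=> _ [m /= nm <-]; exists m => //=; exact: ltnW.
have [||y yT] := cantor T bT _ Tdecr.
- by move=> n; exact: closed_separated_tail sep.
- by under eq_cvg do rewrite muT; exact: cvg_cst.
have [m _ xm] := yT 0%N I.
have [p /= mp xp] := yT m.+1 I.
by apply: (sep m p mp); rewrite xm xp; exact: ballxx.
Qed.

(** The chord inequality applied to t |-> mu (t A + (1 - t) B). *)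
Lemma mu_combination_convex l : 0 < l < 1 ->
  (forall A B : set E, bounded_family E A -> bounded_family E B ->
    mu (combination l A B) <= l * mu A + (1 - l) * mu B) ->
  forall A B : set E, bounded_family E A -> bounded_family E B ->
  forall t, 0 <= t <= 1 ->
    mu (combination t A B) <= t * mu A + (1 - t) * mu B.
Proof.
move=> l01 mul A B bA bB t t01.
have [M [AM BM]] := bounded_family2_norm_ball bA bB.
have [[A0 _] [B0 _]] := (bA, bB).
have bM : bounded_family E (norm_ball M).
  by apply: (@bounded_family_norm_ball _ _ _ M) => //; case: A0 => a /AM; exists a.
have bAB s : 0 <= s <= 1 -> bounded_family E (combination s A B).
  move=> s01; apply: bounded_family_norm_ball.
    exact: combination_nonempty.
  exact: (combination_norm_ball s01 AM BM).
have := @unit_interval_chord R (fun s => mu (combination s A B)) l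
  (mu (norm_ball M)) l01 _ _ t t01.
rewrite combination1// combination0//; apply.
  move=> s s01; apply: mu_mono => //; first exact: bAB.
  exact: (combination_norm_ball s01 AM BM).
move=> s u s01 u01.
apply: le_trans (mul _ _ (bAB _ s01) (bAB _ u01)).
have [/andP[l0 l1] /andP[s0 s1] /andP[u0 u1]] := And3 l01 s01 u01.
apply: mu_mono; [apply: bAB; nra| |exact: combination_sub].
have [M' [AM' BM']] := bounded_family2_norm_ball (bAB _ s01) (bAB _ u01).
apply: (@bounded_family_norm_ball _ _ _ M').
  by apply: combination_nonempty; apply: combination_nonempty.
by apply: (combination_norm_ball _ AM' BM'); rewrite !ltW.
Qed.

End Noncompactness.

Theorem mainTheorem8 (R : realType) (k : scalar_kind)
    (E : completeNormedModType (scalar_field R k))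
    (infE : infinite_dimensional E)
    (mu : set E -> R)
    (mu_ge0 : forall A : set E, bounded_family E A -> 0 <= mu A) :
  axiomatic_mnc mu <->
  [/\ mnc_ker mu !=set0,
      forall A B : set E, bounded_family E A -> bounded_family E B ->
        A `<=` B -> mu A <= mu B,
      forall A : set E, bounded_family E A -> mu (conv_hull A) = mu A,
      exists l : R, 0 < l < 1 /\
        forall A B : set E, bounded_family E A -> bounded_family E B ->
          mu (set_add (set_scale (of_real k l) A)
                      (set_scale (of_real k (1 - l)) B))
            <= l * mu A + (1 - l) * mu B
    & forall A : nat -> set E,
        (forall n, bounded_family E (A n)) -> (forall n, closed (A n)) ->
        (forall n, A n.+1 `<=` A n) ->
        mu (A n) @[n --> \oo] --> (0 : R) ->
        \bigcap_n A n !=set0].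

Proof.
split=> [mnc|[ker0 mono conv [l [l01 mul]] cantor]].
  case: mnc => [[ker0 _] mono conv convex cantor]; split=> //.
  exists (1 / 2); split=> [|A B bA bB]; first lra.
  by apply: convex => //; lra.
split=> //; first by split=> //; exact: mnc_ker_relcompact.
move=> A B bA bB t t01.
exact: (mu_combination_convex mono l01 mul).
Qed.
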